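(* The family of operators $SE_3=DF(a,b,c,g)$, with parameters $a,b,c,g$, admits a shift operator for each of the shifts $$a\to a\pm1,\qquad b\to b\pm1,\qquad c\to c\pm1,\qquad g\to g\pm2$$ (in each case the other three parameters are kept fixed).
   Context: Let $\partial=d/dx$ and $D=\mathbb{C}(x)[\partial]$. The Dotsenko–Fateev operator (called $SE_3$ when viewed as a specialization of a family $E_3$) is $$DF(a,b,c,g)=x^2(x-1)^2\partial^3+F_1\partial^2+F_2\partial+F_3,$$ where $$F_1=-(x-1)x(3ax+3bx+6cx+2gx-3a-3c-g),$$ $$\begin{aligned}F_2=&(2a^2+4ab+12ac+3ag+2b^2+12bc+3bg+12c^2+8cg+g^2+a+b+6c+g)x^2\\&-(4a^2+4ab+16ac+4ag+8bc+2bg+12c^2+8cg+g^2+2a+6c+g)x\\&+2a^2+4ac+ag+2c^2+cg+a+c,\end{aligned}$$ $$F_3=c(2a+2b+2c+g+2)\bigl(-(2a+2b+4c+2g+2)x+2a+2c+g+1\bigr).$$ Shift operators: let $E(p)$ be a family of third-order operators depending on parameters $p$, irreducible for generic $p$, and let $p\to p_+$ be a shift of the parameters by integers. A shift operator for this shift is a non-zero operator $P\in D$ of order lower than $3$, depending on $p$, sending the solution space of $E(p)$ to the solution space of $E(p_+)$; equivalently, there is $Q\in D$ with $E(p_+)\circ P=Q\circ E(p)$. The parameters are regarded as generic (indeterminates); the coefficients of $P$ are rational functions of $x$ and of $p$ (poles in $x$ are allowed; after normalization they may be taken polynomial in $p$ without common factor). *)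

(* Defs.v *)
From HB Require Import structures.
From mathcomp Require Import all_boot all_order all_algebra.
From mathcomp Require Import fraction generic_quotient ring.
From mathcomp Require Import complex reals mpoly.

Set Implicit Arguments.
Unset Strict Implicit.
Unset Printing Implicit Defensive.

Import GRing.Theory.

Local Open Scope ring_scope.

Notation "x %:F" := (@FracField.tofrac _ x).

Notation ratfun K := {fraction {poly K}}.

(* An operator [\sum_i f_i d^i] of K(x)[d] is stored as the polynomial with
   coefficients f_i, written on the left of the powers of d. The product of
   {poly (ratfun K)} is NOT the composition of operators, which is [dcomp]. *)
Notation diffop K := {poly (ratfun K)}.

Lemma quotient_ruleD (F : fieldType) (n m d e n' m' d' e' : F) :
    d != 0 -> e != 0 ->
  ((n' * e + n * e' + (m' * d + m * d')) * (d * e)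
     - (n * e + m * d) * (d' * e + d * e')) / (d * e) ^+ 2
  = (n' * d - n * d') / d ^+ 2 + (m' * e - m * e') / e ^+ 2.
Proof. by move=> d0 e0; field; rewrite d0 e0. Qed.

Lemma quotient_ruleM (F : fieldType) (n m d e n' m' d' e' : F) :
    d != 0 -> e != 0 ->
  ((n' * m + n * m') * (d * e) - n * m * (d' * e + d * e')) / (d * e) ^+ 2
  = (n' * d - n * d') / d ^+ 2 * (m / e)
    + n / d * ((m' * e - m * e') / e ^+ 2).
Proof. by move=> d0 e0; field; rewrite d0 e0. Qed.

Section DifferentialOperators.
Variable K : fieldType.
Implicit Types (u v f : ratfun K) (P Q : diffop K).

(* d/dx; the quotient rule does not depend on the representative, see
   [fderivE]. *)
Definition fderiv u : ratfun K :=
  let r := repr u in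
  ((\n_r)^`() * \d_r - \n_r * (\d_r)^`())%:F / (\d_r ^+ 2)%:F.

Lemma fracE u : u = (\n_(repr u))%:F / (\d_(repr u))%:F.
Proof.
have d0 : (\d_(repr u))%:F != 0 :> ratfun K by rewrite tofrac_eq0 denom_ratioP.
apply: (mulIf d0); rewrite divfK //.
move: (denom_ratioP (repr u)); rewrite -{2}[u]reprK; move: (repr u) => r r0.
unlock FracField.tofrac; rewrite -[LHS]FracField.pi_mul; apply/eqmodP => /=.
rewrite FracField.equivfE /FracField.mulf !numden_Ratio ?oner_neq0 ?mulf_neq0 ?oner_neq0 //.
by rewrite !mulr1 mulrC.
Qed.

Lemma eq_frac (n d m e : {poly K}) : d != 0 -> e != 0 ->
  (n%:F / d%:F == m%:F / e%:F :> ratfun K) = (n * e == m * d).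
Proof.
move=> d0 e0; have fd0 : d%:F != 0 :> ratfun K by rewrite tofrac_eq0.
have fe0 : e%:F != 0 :> ratfun K by rewrite tofrac_eq0.
by rewrite (eqr_div _ _ fd0 fe0) -2!tofracM tofrac_eq.
Qed.

Lemma fderivE (n d : {poly K}) : d != 0 ->
  fderiv (n%:F / d%:F) = (n^`() * d - n * d^`())%:F / (d ^+ 2)%:F.
Proof.
move=> d0; have := fracE (n%:F / d%:F); rewrite /fderiv.
move: (repr _) => r; move: (denom_ratioP r).
move: (\n_r) (\d_r) => m e e0 /eqP; rewrite (eq_frac _ _ d0 e0) => /eqP E.
apply/eqP; rewrite (eq_frac _ _ (expf_neq0 2 e0) (expf_neq0 2 d0)); apply/eqP.
have := congr1 (@deriv K) E; rewrite !derivM => E'.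
have -> : (m^`() * e - m * e^`()) * d ^+ 2
  = e * d * (m^`() * d + m * d^`()) - (m * d) * (e * d^`() + e^`() * d) by ring.
have -> : (n^`() * d - n * d^`()) * e ^+ 2
  = e * d * (n^`() * e + n * e^`()) - (n * e) * (e^`() * d + e * d^`()) by ring.
by rewrite E' E; ring.
Qed.

Lemma fderiv_poly (p : {poly K}) : fderiv p%:F = (p^`())%:F.
Proof.
have := fderivE p (oner_neq0 {poly K}); rewrite expr1n tofrac1 2!divr1 => ->.
by rewrite -(polyC1 K) derivC mulr0 subr0 mulr1.
Qed.

Lemma fderivD u v : fderiv (u + v) = fderiv u + fderiv v.
Proof.
rewrite (fracE u) (fracE v); move: (repr u) (repr v) => r s.
move: (denom_ratioP r) (denom_ratioP s).
move: (\n_r) (\d_r) (\n_s) (\d_s) => n d m e d0 e0.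
have fd0 : d%:F != 0 :> ratfun K by rewrite tofrac_eq0.
have fe0 : e%:F != 0 :> ratfun K by rewrite tofrac_eq0.
rewrite (addf_div _ _ fd0 fe0) -3!tofracM -tofracD.
rewrite (fderivE _ (mulf_neq0 d0 e0)) (fderivE _ d0) (fderivE _ e0).
rewrite derivD !derivM !(tofracXn, tofracB, tofracD, tofracM).
exact: quotient_ruleD fd0 fe0.
Qed.

Lemma fderivM u v : fderiv (u * v) = fderiv u * v + u * fderiv v.
Proof.
rewrite (fracE u) (fracE v); move: (repr u) (repr v) => r s.
move: (denom_ratioP r) (denom_ratioP s).
move: (\n_r) (\d_r) (\n_s) (\d_s) => n d m e d0 e0.
have fd0 : d%:F != 0 :> ratfun K by rewrite tofrac_eq0.
have fe0 : e%:F != 0 :> ratfun K by rewrite tofrac_eq0.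
rewrite mulf_div -2!tofracM.
rewrite (fderivE _ (mulf_neq0 d0 e0)) (fderivE _ d0) (fderivE _ e0).
rewrite !derivM !(tofracXn, tofracB, tofracD, tofracM).
exact: quotient_ruleM fd0 fe0.
Qed.

Lemma fderiv0 : fderiv 0 = 0.
Proof. by rewrite -tofrac0 fderiv_poly deriv0. Qed.

(* d o (\sum_j f_j d^j) = \sum_j f_j d^(j+1) + \sum_j f_j' d^j *)
Definition dcompX Q : diffop K := Q * 'X + map_poly fderiv Q.

Definition dcomp P Q : diffop K := \sum_(i < size P) P`_i *: iter i dcompX Q.

Definition dapp P f : ratfun K := \sum_(i < size P) P`_i * iter i fderiv f.

(* E is E(p) and E' is E(p_+), both of order 3. E' o P = Q o E says that P sends
   the solutions of E to solutions of E'. *)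
Definition shift_operator (E E' P : diffop K) : Prop :=
  [/\ P != 0, ((size P).-1 < 3)%N & exists Q, dcomp E' P = dcomp Q E].

Definition DF1 (a b c g : K) : {poly K} :=
  - (('X - 1) * 'X * ((3 * a + 3 * b + 6 * c + 2 * g)%:P * 'X
                      - (3 * a + 3 * c + g)%:P)).

Definition DF2 (a b c g : K) : {poly K} :=
  (2 * a ^+ 2 + 4 * a * b + 12 * a * c + 3 * a * g + 2 * b ^+ 2
   + 12 * b * c + 3 * b * g + 12 * c ^+ 2 + 8 * c * g + g ^+ 2
   + a + b + 6 * c + g)%:P * 'X ^+ 2
  - (4 * a ^+ 2 + 4 * a * b + 16 * a * c + 4 * a * g + 8 * b * c
     + 2 * b * g + 12 * c ^+ 2 + 8 * c * g + g ^+ 2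
     + 2 * a + 6 * c + g)%:P * 'X
  + (2 * a ^+ 2 + 4 * a * c + a * g + 2 * c ^+ 2 + c * g + a + c)%:P.

Definition DF3 (a b c g : K) : {poly K} :=
  (c * (2 * a + 2 * b + 2 * c + g + 2))%:P
  * (- (2 * a + 2 * b + 4 * c + 2 * g + 2)%:P * 'X
     + (2 * a + 2 * c + g + 1)%:P).

Definition DF (a b c g : K) : diffop K :=
  ('X ^+ 2 * ('X - 1) ^+ 2 : {poly K})%:F *: 'X ^+ 3
  + (DF1 a b c g)%:F *: 'X ^+ 2
  + (DF2 a b c g)%:F *: 'X
  + ((DF3 a b c g)%:F)%:P.

Lemma dapp_wide n P f : (size P <= n)%N ->
  dapp P f = \sum_(i < n) P`_i * iter i fderiv f.
Proof.
move=> le; rewrite /dapp (big_ord_widen n (fun i => P`_i * iter i fderiv f)) //.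
rewrite big_mkcond; apply: eq_bigr => i _; case: ltnP => // ge.
by rewrite nth_default // mul0r.
Qed.

Lemma dappD P Q f : dapp (P + Q) f = dapp P f + dapp Q f.
Proof.
pose n := maxn (size P) (size Q).
rewrite !(@dapp_wide n) ?leq_maxl ?leq_maxr ?size_polyD // -big_split /=.
by apply: eq_bigr => i _; rewrite coefD mulrDl.
Qed.

Lemma dappZ u P f : dapp (u *: P) f = u * dapp P f.
Proof.
rewrite !(@dapp_wide (size P)) ?size_scale_leq // mulr_sumr.
by apply: eq_bigr => i _; rewrite coefZ mulrA.
Qed.

Lemma fderiv_sum n (F : 'I_n -> ratfun K) :
  fderiv (\sum_(i < n) F i) = \sum_(i < n) fderiv (F i).
Proof. exact: (big_morph _ fderivD fderiv0). Qed.

Lemma dapp_dcompX Q f : dapp (dcompX Q) f = fderiv (dapp Q f).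
Proof.
rewrite dappD (@dapp_wide (size Q).+1 (Q * 'X)); last first.
  by have [->|Q0] := eqVneq Q 0; rewrite ?mul0r ?size_poly0 // size_mulX.
rewrite (@dapp_wide (size Q) (map_poly _ _)) ?size_poly // big_ord_recl.
rewrite coefMX eqxx mul0r add0r /dapp fderiv_sum -big_split /=.
apply: eq_bigr => i _; rewrite coefMX fderivM /= coef_map_id0 ?fderiv0 //.
by rewrite addrC.
Qed.

Lemma dapp_dcomp P Q f : dapp (dcomp P Q) f = dapp P (dapp Q f).
Proof.
have dapp0 : dapp 0 f = 0 by rewrite /dapp size_poly0 big_ord0.
rewrite /dcomp (big_morph (dapp^~ f) (fun A B => dappD A B f) dapp0).
apply: eq_bigr => i _; rewrite dappZ; congr (_ * _).
by elim: (i : nat) => //= n IH; rewrite dapp_dcompX IH.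
Qed.

End DifferentialOperators.

(* C(a, b, c, g), the field of rational functions in four indeterminates; as R
   is a complete archimedean ordered field, R[i] is the field of complex
   numbers. *)
Definition parfield (R : realType) : fieldType := {fraction {mpoly R[i][4]}}.

Section Shifts.
Variable R : realType.

Definition par_a : parfield R := ('X_(@Ordinal 4 0 isT))%:F.
Definition par_b : parfield R := ('X_(@Ordinal 4 1 isT))%:F.
Definition par_c : parfield R := ('X_(@Ordinal 4 2 isT))%:F.
Definition par_g : parfield R := ('X_(@Ordinal 4 3 isT))%:F.

(* The coefficients of P and Q range over C(a, b, c, g)(x): they are rational
   in x and in the generic parameters. *)
Definition admits_shift
    (E : parfield R -> parfield R -> parfield R -> parfield R ->
         diffop (parfield R))
    (da db dc dg : int) : Prop :=
  exists P : diffop (parfield R),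
    shift_operator
      (E par_a par_b par_c par_g)
      (E (par_a + da%:~R) (par_b + db%:~R) (par_c + dc%:~R) (par_g + dg%:~R))
      P.

End Shifts.

(* Main.v *)
Require Import Defs.
From mathcomp Require Import all_boot all_order all_algebra.
From mathcomp Require Import fraction ring.
From mathcomp Require Import complex reals mpoly.

(* Solutions of DF(a,b,c,g) are the integrals over (t1, t2) of
   \prod_i t_i^a (t_i-1)^b (t_i-x)^c . (t1-t2)^g, whose local exponents at
   0, 1, oo bound the poles and the degrees of the coefficients of a shift
   operator P. As P is unique up to a constant, solving the resulting linear
   system gives it explicitly. The operator Q with E(p_+) P = Q E(p) comes from
   duality: the formal adjoint of DF(a,b,c,g) is -DF(-a-1,-b-1,-c-1,-g), so the
   adjoint of Q is, up to sign, P taken at the dual parameters of p_+. What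
   remains is to compare the six coefficients of E(p_+) P and Q E(p). *)

Set Implicit Arguments.
Unset Strict Implicit.
Unset Printing Implicit Defensive.

Import GRing.Theory Num.Theory.

Local Open Scope ring_scope.

(** * The intertwining relation in terms of coefficients *)

Section Intertwining.
Variables (F : fieldType) (d : F -> F).
Implicit Types e f p q : seq F.

(* Equality of the coefficients of d^5, d^4, ..., d^0 in f o p and q o e, for
   e, f of order 3 and p, q of order 2. *)
Definition intertwines e f p q : Prop :=
  [/\ f`_3 * p`_2 = q`_2 * e`_3,
      f`_3 * (p`_1 + 3 * d p`_2) + f`_2 * p`_2
      = q`_2 * (e`_2 + 2 * d e`_3) + q`_1 * e`_3,
      f`_3 * (p`_0 + 3 * d p`_1 + 3 * d (d p`_2))
        + f`_2 * (p`_1 + 2 * d p`_2) + f`_1 * p`_2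
      = q`_2 * (e`_1 + 2 * d e`_2 + d (d e`_3))
        + q`_1 * (e`_2 + d e`_3) + q`_0 * e`_3,
      f`_3 * (3 * d p`_0 + 3 * d (d p`_1) + d (d (d p`_2)))
        + f`_2 * (p`_0 + 2 * d p`_1 + d (d p`_2))
        + f`_1 * (p`_1 + d p`_2) + f`_0 * p`_2
      = q`_2 * (e`_0 + 2 * d e`_1 + d (d e`_2))
        + q`_1 * (e`_1 + d e`_2) + q`_0 * e`_2
    & f`_3 * (3 * d (d p`_0) + d (d (d p`_1)))
        + f`_2 * (2 * d p`_0 + d (d p`_1))
        + f`_1 * (p`_0 + d p`_1) + f`_0 * p`_1
      = q`_2 * (2 * d e`_0 + d (d e`_1)) + q`_1 * (e`_0 + d e`_1)
        + q`_0 * e`_1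
    /\ f`_3 * d (d (d p`_0)) + f`_2 * d (d p`_0) + f`_1 * d p`_0 + f`_0 * p`_0
      = q`_2 * d (d e`_0) + q`_1 * d e`_0 + q`_0 * e`_0].

(** The formal adjoint sum_i (-d)^i o p_i of an operator of order 2, expanded by the Leibniz
    rule. *)
Definition adjoint p : seq F :=
  [:: d (d p`_2) - d p`_1 + p`_0; 2 * d p`_2 - p`_1; p`_2].

End Intertwining.

(** * Composition of operators given by coefficient lists *)

Section Composition.
Variable K : fieldType.
Implicit Types (u : ratfun K) (s e f p q : seq (ratfun K)) (P Q : diffop K).

(** Left composition with d is [dshift 0 s]; the accumulator [u] carries the previous coefficient,
    which d moves up one degree. *)
Fixpoint dshift u s : seq (ratfun K) :=
  if s is v :: s' then u + fderiv v :: dshift v s' else [:: u].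

Lemma nth_dshift u s i :
  (dshift u s)`_i = (u :: s)`_i + fderiv s`_i.
Proof.
elim: s u i => [|v s IH] u [|i] //=.
- by rewrite fderiv0 addr0.
- by rewrite !nth_nil fderiv0 addr0.
Qed.

Lemma dcompX_Poly s : dcompX (Poly s) = Poly (dshift 0 s).
Proof.
apply/polyP=> i; rewrite coefD coefMX coef_map_id0 ?fderiv0 // !coef_Poly.
by rewrite nth_dshift; case: i.
Qed.

Lemma dcomp_wide n P Q : (size P <= n)%N ->
  dcomp P Q = \sum_(i < n) P`_i *: iter i (@dcompX K) Q.
Proof.
move=> le; rewrite /dcomp.
rewrite (big_ord_widen n (fun i => P`_i *: iter i (@dcompX K) Q)) //.
rewrite big_mkcond; apply: eq_bigr => i _; case: ltnP => // ge.
by rewrite nth_default // scale0r.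
Qed.

(** Composing the right factor with d at each call replaces the iterates in [dcomp] by a recursion
    that unfolds on explicit lists. *)
Fixpoint dcomp_seq s Q : diffop K :=
  if s is f :: s' then f *: Q + dcomp_seq s' (dcompX Q) else 0.

Lemma dcomp_Poly s Q : dcomp (Poly s) Q = dcomp_seq s Q.
Proof.
rewrite (dcomp_wide _ (size_Poly s)).
under eq_bigr do rewrite coef_Poly.
elim: s Q => [|f s IH] Q /=; first by rewrite big_ord0.
rewrite big_ord_recl -IH; congr (_ + _).
by apply: eq_bigr => i _; rewrite /= -iterS iterSr.
Qed.

Lemma intertwines_dcomp e f p q :
    size e = 4 -> size f = 4 -> size p = 3 -> size q = 3 ->
  intertwines (@fderiv K) e f p q ->
  dcomp (Poly f) (Poly p) = dcomp (Poly q) (Poly e).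
Proof.
move: e f => [|e0 [|e1 [|e2 [|e3 []]]]] // [|f0 [|f1 [|f2 [|f3 []]]]] // _ _.
move: p q => [|p0 [|p1 [|p2 []]]] // [|q0 [|q1 [|q2 []]]] // _ _.
rewrite !dcomp_Poly /dcomp_seq !dcompX_Poly /dshift.
case=> H5 H4 H3 H2 [H1 H0].
apply/polyP=> i; rewrite !(coefD, coefZ, coef0, coef_Poly).
(* Degrees 0 to 5 give the six equations, in the reverse of their order in [intertwines]; beyond
   degree 5 both sides vanish. *)
case: i => [|[|[|[|[|[|i]]]]]] /=; rewrite ?nth_nil ?(fderivD, fderiv0).
- by apply: (etrans (etrans _ H0)) => /=; ring.
- by apply: (etrans (etrans _ H1)) => /=; ring.
- by apply: (etrans (etrans _ H2)) => /=; ring.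
- by apply: (etrans (etrans _ H3)) => /=; ring.
- by apply: (etrans (etrans _ H4)) => /=; ring.
- by apply: (etrans (etrans _ H5)) => /=; ring.
- by ring.
Qed.

Lemma shift_operator_Poly e f p q :
    size e = 4 -> size f = 4 -> size p = 3 -> size q = 3 ->
    p`_2 != 0 -> intertwines (@fderiv K) e f p q ->
  shift_operator (Poly e) (Poly f) (Poly p).
Proof.
move=> se sf sp sq p2 epq; split.
- by apply: contra_neq p2 => /(congr1 (fun P : diffop K => P`_2));
     rewrite coef_Poly coef0.
- by move: (size_Poly p); rewrite sp; case: (size _).
- by exists (Poly q); apply: intertwines_dcomp.
Qed.

End Composition.

(** * Explicit shift operators over an abstract differential field *)

Section ExplicitOperators.
Variables (K F : fieldType) (iota : {rmorphism K -> F}) (d : F -> F) (x : F).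
Hypothesis dD : forall u v : F, d (u + v) = d u + d v.
Hypothesis dM : forall u v : F, d (u * v) = d u * v + u * d v.
Hypothesis dC : forall k, d (iota k) = 0.
Hypothesis dx : d x = 1.
Hypotheses (x0 : x != 0) (x1 : x - 1 != 0).

(** A partial fraction shape common to all coefficients below: degree at most 4, simple poles at 0
    and 1. Its first three derivatives suffice, since [intertwines] and [adjoint] never
    differentiate a coefficient more often. *)
Definition pfrac k0 k1 k2 k3 k4 u v : F :=
  iota k0 + iota k1 * x + iota k2 * x ^+ 2 + iota k3 * x ^+ 3
  + iota k4 * x ^+ 4 + iota u * x^-1 + iota v * (x - 1)^-1.

Definition pfrac1 k1 k2 k3 k4 u v : F :=
  iota k1 + 2 * iota k2 * x + 3 * iota k3 * x ^+ 2 + 4 * iota k4 * x ^+ 3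
  - iota u * x^-1 ^+ 2 - iota v * (x - 1)^-1 ^+ 2.

Definition pfrac2 k2 k3 k4 u v : F :=
  2 * iota k2 + 6 * iota k3 * x + 12 * iota k4 * x ^+ 2
  + 2 * iota u * x^-1 ^+ 3 + 2 * iota v * (x - 1)^-1 ^+ 3.

Definition pfrac3 k3 k4 u v : F :=
  6 * iota k3 + 24 * iota k4 * x
  - 6 * iota u * x^-1 ^+ 4 - 6 * iota v * (x - 1)^-1 ^+ 4.

Lemma d1 : d 1 = 0.
Proof. by rewrite -(rmorph1 iota) dC. Qed.

Lemma dN (u : F) : d (- u) = - d u.
Proof.
have d0 : d 0 = 0 by rewrite -(rmorph0 iota) dC rmorph0.
by apply/eqP; rewrite -addr_eq0 -dD addNr d0.
Qed.

Lemma dnat n : d n%:R = 0.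
Proof. by rewrite -(rmorph_nat iota) dC. Qed.

Lemma dV (u : F) : u != 0 -> d u = 1 -> d u^-1 = - u^-1 ^+ 2.
Proof.
move=> u0 u1; have := congr1 d (mulfV u0); rewrite dM d1 u1 mul1r => /eqP.
rewrite addr_eq0 -eqr_oppLR => /eqP E.
by apply: (mulfI u0); rewrite -E mulrN expr2 mulVKf.
Qed.

Lemma d_pfrac k0 k1 k2 k3 k4 u v :
  d (pfrac k0 k1 k2 k3 k4 u v) = pfrac1 k1 k2 k3 k4 u v.
Proof.
have dx1 : d (x - 1) = 1 by rewrite dD dN dx d1 subr0.
rewrite /pfrac /pfrac1 !(dD, dM, dC, exprS, expr0, d1, dx).
rewrite (dV x0 dx) (dV x1 dx1).
by ring.
Qed.

Lemma d_pfrac1 k1 k2 k3 k4 u v :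
  d (pfrac1 k1 k2 k3 k4 u v) = pfrac2 k2 k3 k4 u v.
Proof.
have dx1 : d (x - 1) = 1 by rewrite dD dN dx d1 subr0.
rewrite /pfrac1 /pfrac2 !(dD, dN, dM, dC, dnat, exprS, expr0, d1, dx).
rewrite (dV x0 dx) (dV x1 dx1).
by ring.
Qed.

Lemma d_pfrac2 k2 k3 k4 u v : d (pfrac2 k2 k3 k4 u v) = pfrac3 k3 k4 u v.
Proof.
have dx1 : d (x - 1) = 1 by rewrite dD dN dx d1 subr0.
rewrite /pfrac2 /pfrac3 !(dD, dN, dM, dC, dnat, exprS, expr0, d1, dx).
rewrite (dV x0 dx) (dV x1 dx1).
by ring.
Qed.

(* Operators are listed from the coefficient of d^0 upwards. *)
Definition DFseq a b c g : seq F :=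
  let k := c * (2 * a + 2 * b + 2 * c + g + 2) in
  let m := 3 * a + 3 * c + g in
  let n := 3 * a + 3 * b + 6 * c + 2 * g in
  [:: pfrac (k * (2 * a + 2 * c + g + 1))
        (- (k * (2 * a + 2 * b + 4 * c + 2 * g + 2))) 0 0 0 0 0;
      pfrac
        (2 * a ^+ 2 + 4 * a * c + a * g + 2 * c ^+ 2 + c * g + a + c)
        (- (4 * a ^+ 2 + 4 * a * b + 16 * a * c + 4 * a * g + 8 * b * c
            + 2 * b * g + 12 * c ^+ 2 + 8 * c * g + g ^+ 2
            + 2 * a + 6 * c + g))
        (2 * a ^+ 2 + 4 * a * b + 12 * a * c + 3 * a * g + 2 * b ^+ 2
         + 12 * b * c + 3 * b * g + 12 * c ^+ 2 + 8 * c * g + g ^+ 2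
         + a + b + 6 * c + g) 0 0 0 0;
      pfrac 0 (- m) (m + n) (- n) 0 0 0;
      pfrac 0 0 1 (-2) 1 0 0].

(** The raising operators factor as s x^2 (x-1)^2 d^2 - x (x-1) (n x - m) d + (a quadratic in x),
    with s = 1 except in [raise_g]. *)
Definition raise_a a b c g : seq F :=
  let m := 3 * a + 3 * c + g + 2 in
  let n := a + b + 4 * c + g in
  [:: pfrac ((a + c + 1) * (2 * a + 2 * c + g + 2))
         (- (c * (6 * a + 2 * b + 6 * c + 3 * g + 6)))
         (2 * c * (a + b + 2 * c + g + 1)) 0 0 0 0;
      pfrac 0 (- m) (m + n) (- n) 0 0 0;
      pfrac 0 0 1 (-2) 1 0 0].

(** The image of [raise_a] under x -> 1 - x, d -> -d and the exchange of a and b; [lower_b] arises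
    from [lower_a] in the same way. *)
Definition raise_b a b c g : seq F :=
  let m := a - 2 * b + c - 2 in
  let n := a + b + 4 * c + g in
  [:: pfrac ((b + 1) * (2 * b + g + 2))
         (c * (2 * b - 2 * a - 2 * c - g + 2))
         (2 * c * (a + b + 2 * c + g + 1)) 0 0 0 0;
      pfrac 0 (- m) (m + n) (- n) 0 0 0;
      pfrac 0 0 1 (-2) 1 0 0].

(** [A] and [B] are the values at 0 and 1 of the coefficient of d^0; the symmetry x -> 1 - x
    exchanges them. *)
Definition raise_c a b c g : seq F :=
  let m := 3 * a + 3 * c + g + 2 in
  let n := 3 * a + 3 * b + 6 * c + 2 * g + 4 in
  let A := (a + c + 1) * (2 * a + 2 * c + g + 2) in
  let B := (b + c + 1) * (2 * b + 2 * c + g + 2) in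
  let k := 2 * a ^+ 2 + 4 * a * b + 10 * a * c + 3 * a * g + 2 * b ^+ 2
    + 10 * b * c + 3 * b * g + 10 * c ^+ 2 + 7 * c * g + g ^+ 2
    + 8 * a + 8 * b + 18 * c + 6 * g + 8 in
  [:: pfrac A (B - A - k) k 0 0 0 0;
      pfrac 0 (- m) (m + n) (- n) 0 0 0;
      pfrac 0 0 1 (-2) 1 0 0].

(** The factor [s] clears the denominators in the parameters. *)
Definition raise_g a b c g : seq F :=
  let t := a + b + c in
  let h := 4 * t + 8 * g + 14 in
  let m := (a + c) * h + 2 * (g + 1) * (g + 2) in
  let n := (a + b + 2 * c) * h + 4 * (g + 1) * (g + 2) in
  let k := c * (8 * (t + g + 2) ^+ 2 + 4 * c * (g + 1) - 2 * (g + 2)) in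
  let s := 2 * t + 3 * (g + 2) in
  [:: pfrac (- ((g + 1) * (2 * a + 2 * c + g + 2) * (2 * b + g + 2)))
         (- (4 * c * (a - b) * (g + 1)) - k) k 0 0 0 0;
      pfrac 0 (- m) (m + n) (- n) 0 0 0;
      pfrac 0 0 s (- 2 * s) s 0 0].

(** [t] is a factor of [DF3]: when it vanishes, constants are solutions, and all four lowering
    operators annihilate them. *)
Definition lower_a a b c g : seq F :=
  let t := 2 * a + 2 * b + 2 * c + g + 2 in
  [:: pfrac ((a + b + 2 * c + g + 1) * t) 0 0 0 0 (- (c * t)) 0;
      pfrac (4 * a + 3 * b + 5 * c + 2 * g + 2)
         (- (3 * a + 3 * b + 4 * c + 2 * g + 2)) 0 0 0 (- (a + c)) 0;
      pfrac 1 (-2) 1 0 0 0 0].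

Definition lower_b a b c g : seq F :=
  let t := 2 * a + 2 * b + 2 * c + g + 2 in
  [:: pfrac ((a + b + 2 * c + g + 1) * t) 0 0 0 0 0 (c * t);
      pfrac (- (b + c)) (- (3 * a + 3 * b + 4 * c + 2 * g + 2))
         0 0 0 0 (- (b + c));
      pfrac 0 0 1 0 0 0 0].

Definition lower_c a b c g : seq F :=
  let t := 2 * a + 2 * b + 2 * c + g + 2 in
  [:: pfrac 0 0 0 0 0 (- (c * t)) (c * t);
      pfrac 0 0 0 0 0 (- (a + c)) (- (b + c));
      pfrac 1 0 0 0 0 0 0].

(** The coefficient of d^2 takes the values [A] at 0 and [B] at 1, and its leading coefficient is
    [C]. *)
Definition lower_g a b c g : seq F :=
  let t := 2 * a + 2 * b + 2 * c + g + 2 in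
  let A := (2 * b + g) * (a + c + g) in
  let B := (2 * a + g) * (b + c + g) in
  let C := (2 * c + g) * (a + b + g) in
  [:: pfrac (C * (a + b + 2 * c + g + 1) * t) 0 0 0 0
         (- (c * t * A)) (c * t * B);
      pfrac ((2 * c + g)
             * (3 * a * b - a * c + 2 * a * g + 3 * b ^+ 2 + 5 * b * c
                + 3 * b * g + 2 * c * g + g ^+ 2 + 2 * b + g))
         (- (C * (3 * a + 3 * b + 4 * c + 2 * g + 2))) 0 0 0
         (- ((a + c) * A)) (- ((b + c) * B));
      pfrac A (- ((2 * b + g) * (2 * c + g))) C 0 0 0 0].

(** Once the derivatives are in closed form, what is left is six rational identities whose only
    denominators are powers of x and x - 1. *)
Ltac coefficient_identities :=
  rewrite /intertwines /=;
  rewrite !(d_pfrac, d_pfrac1, d_pfrac2) /pfrac /pfrac1 /pfrac2 /pfrac3;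
  split; last split; field; rewrite ?x0 ?x1.

(** Taking adjoints reverses the arrow and dualizing negates the shift, so the adjoint of Q goes
    from the dual of p_+ to the dual of p, again raising a by 1. Hence the same formula serves for P
    and Q. *)
Lemma raise_a_intertwines a b c g :
  intertwines d (DFseq a b c g) (DFseq (a + 1) b c g) (raise_a a b c g)
    (adjoint d (raise_a (- a - 2) (- b - 1) (- c - 1) (- g))).
Proof. by coefficient_identities. Qed.

Lemma lower_a_intertwines a b c g :
  intertwines d (DFseq a b c g) (DFseq (a - 1) b c g) (lower_a a b c g)
    (adjoint d (lower_a (- a) (- b - 1) (- c - 1) (- g))).
Proof. by coefficient_identities. Qed.

Lemma raise_b_intertwines a b c g :
  intertwines d (DFseq a b c g) (DFseq a (b + 1) c g) (raise_b a b c g)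
    (adjoint d (raise_b (- a - 1) (- b - 2) (- c - 1) (- g))).
Proof. by coefficient_identities. Qed.

Lemma lower_b_intertwines a b c g :
  intertwines d (DFseq a b c g) (DFseq a (b - 1) c g) (lower_b a b c g)
    (adjoint d (lower_b (- a - 1) (- b) (- c - 1) (- g))).
Proof. by coefficient_identities. Qed.

Lemma raise_c_intertwines a b c g :
  intertwines d (DFseq a b c g) (DFseq a b (c + 1) g) (raise_c a b c g)
    (adjoint d (raise_c (- a - 1) (- b - 1) (- c - 2) (- g))).
Proof. by coefficient_identities. Qed.

Lemma lower_c_intertwines a b c g :
  intertwines d (DFseq a b c g) (DFseq a b (c - 1) g) (lower_c a b c g)
    (adjoint d (lower_c (- a - 1) (- b - 1) (- c) (- g))).
Proof. by coefficient_identities. Qed.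

(** The leading coefficients of P and Q must agree, but [s] changes sign at the dual parameters of
    p_+; hence the minus sign. *)
Lemma raise_g_intertwines a b c g :
  intertwines d (DFseq a b c g) (DFseq a b c (g + 2)) (raise_g a b c g)
    [seq - u | u <- adjoint d
      (raise_g (- a - 1) (- b - 1) (- c - 1) (- g - 2))].
Proof. by coefficient_identities. Qed.

Lemma lower_g_intertwines a b c g :
  intertwines d (DFseq a b c g) (DFseq a b c (g - 2)) (lower_g a b c g)
    (adjoint d (lower_g (- a - 1) (- b - 1) (- c - 1) (- g + 2))).
Proof. by coefficient_identities. Qed.

End ExplicitOperators.

(** * Specialization to rational functions of x *)

Section RationalFunctions.
Variable K : fieldType.
Implicit Types a b c g k : K.
Notation x := (('X : {poly K})%:F).

Definition cst : {rmorphism K -> ratfun K} :=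
  (@FracField.tofrac {poly K}) \o polyC.

Lemma x_neq0 : x != 0.
Proof. by rewrite tofrac_eq0 polyX_eq0. Qed.

Lemma x_sub1_neq0 : x - 1 != 0.
Proof. by rewrite -tofrac1 -tofracB tofrac_eq0 -polyC1 polyXsubC_eq0. Qed.

Lemma fderivX : fderiv x = 1.
Proof. by rewrite fderiv_poly derivX tofrac1. Qed.

Lemma fderivC k : fderiv (cst k) = 0.
Proof. by rewrite fderiv_poly derivC tofrac0. Qed.

Lemma pfrac_poly k0 k1 k2 k3 k4 :
  pfrac cst x k0 k1 k2 k3 k4 0 0 = (Poly [:: k0; k1; k2; k3; k4])%:F.
Proof.
rewrite /pfrac !rmorph0 !mul0r !addr0 /= !cons_poly_def.
by rewrite !(tofracD, tofracM) tofrac0; ring.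
Qed.

(** Used for the coefficient of d^2 of each shift operator, with [i] its degree in x. *)
Lemma pfrac_neq0 i k0 k1 k2 k3 k4 :
  [:: k0; k1; k2; k3; k4]`_i != 0 -> pfrac cst x k0 k1 k2 k3 k4 0 0 != 0.
Proof.
rewrite pfrac_poly tofrac_eq0 -coef_Poly.
by apply: contra_neq => ->; rewrite coef0.
Qed.

Lemma DF_Poly a b c g : DF a b c g = Poly (DFseq cst x a b c g).
Proof.
apply/polyP=> i; rewrite /DF !(coefD, coefZ, coefXn, coefX, coefC) coef_Poly.
case: i => [|[|[|[|i]]]] /=; rewrite ?nth_nil !(mulr0, mulr1, addr0, add0r) //;
  by rewrite pfrac_poly; congr _%:F;
     rewrite /DF1 /DF2 /DF3 /= !cons_poly_def; ring.
Qed.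

(** Parameters are arbitrary here: only the shifts of g require a condition, the other leading
    coefficients being free of parameters. *)
Definition shiftable a b c g (da db dc dg : int) : Prop :=
  exists P, shift_operator (DF a b c g)
    (DF (a + da%:~R) (b + db%:~R) (c + dc%:~R) (g + dg%:~R)) P.

Lemma intertwines_shiftable a b c g da db dc dg (p q : seq (ratfun K)) :
    intertwines (@fderiv K) (DFseq cst x a b c g)
      (DFseq cst x (a + da%:~R) (b + db%:~R) (c + dc%:~R) (g + dg%:~R)) p q ->
    size p = 3 -> size q = 3 -> p`_2 != 0 ->
  shiftable a b c g da db dc dg.
Proof.
move=> epq sp sq p2; exists (Poly p).
by rewrite !DF_Poly; apply: shift_operator_Poly epq.
Qed.

Let dD := @fderivD K.
Let dM := @fderivM K.

Lemma DF_raise_a a b c g : shiftable a b c g 1 0 0 0.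
Proof.
apply: intertwines_shiftable.
(* The integer casts of the shifts compute, so [addr0] also removes the zero shifts [0%:~R]. *)
- rewrite !addr0.
  exact: (raise_a_intertwines dD dM fderivC fderivX x_neq0 x_sub1_neq0).
- by [].
- by [].
- by apply: (@pfrac_neq0 4); exact: oner_neq0.
Qed.

Lemma DF_lower_a a b c g : shiftable a b c g (-1) 0 0 0.
Proof.
apply: intertwines_shiftable.
- rewrite !addr0.
  exact: (lower_a_intertwines dD dM fderivC fderivX x_neq0 x_sub1_neq0).
- by [].
- by [].
- by apply: (@pfrac_neq0 2); exact: oner_neq0.
Qed.

Lemma DF_raise_b a b c g : shiftable a b c g 0 1 0 0.
Proof.
apply: intertwines_shiftable.
- rewrite !addr0.
  exact: (raise_b_intertwines dD dM fderivC fderivX x_neq0 x_sub1_neq0).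
- by [].
- by [].
- by apply: (@pfrac_neq0 4); exact: oner_neq0.
Qed.

Lemma DF_lower_b a b c g : shiftable a b c g 0 (-1) 0 0.
Proof.
apply: intertwines_shiftable.
- rewrite !addr0.
  exact: (lower_b_intertwines dD dM fderivC fderivX x_neq0 x_sub1_neq0).
- by [].
- by [].
- by apply: (@pfrac_neq0 2); exact: oner_neq0.
Qed.

Lemma DF_raise_c a b c g : shiftable a b c g 0 0 1 0.
Proof.
apply: intertwines_shiftable.
- rewrite !addr0.
  exact: (raise_c_intertwines dD dM fderivC fderivX x_neq0 x_sub1_neq0).
- by [].
- by [].
- by apply: (@pfrac_neq0 4); exact: oner_neq0.
Qed.

Lemma DF_lower_c a b c g : shiftable a b c g 0 0 (-1) 0.
Proof.
apply: intertwines_shiftable.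
- rewrite !addr0.
  exact: (lower_c_intertwines dD dM fderivC fderivX x_neq0 x_sub1_neq0).
- by [].
- by [].
- by apply: (@pfrac_neq0 0); exact: oner_neq0.
Qed.

Lemma DF_raise_g a b c g :
  2 * (a + b + c) + 3 * (g + 2) != 0 -> shiftable a b c g 0 0 0 2.
Proof.
move=> s0; apply: intertwines_shiftable.
- rewrite !addr0.
  exact: (raise_g_intertwines dD dM fderivC fderivX x_neq0 x_sub1_neq0).
- by [].
- by [].
- by apply: (@pfrac_neq0 4).
Qed.

Lemma DF_lower_g a b c g :
  (2 * c + g) * (a + b + g) != 0 -> shiftable a b c g 0 0 0 (-2).
Proof.
move=> s0; apply: intertwines_shiftable.
- rewrite !addr0.
  exact: (lower_g_intertwines dD dM fderivC fderivX x_neq0 x_sub1_neq0).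
- by [].
- by [].
- by apply: (@pfrac_neq0 2).
Qed.

End RationalFunctions.

(** * Genericity of the parameters, by evaluation at a point *)

Lemma parfield_neq0 (R : realType) (v : 'I_4 -> R[i]) (p : {mpoly R[i][4]}) :
  p.@[v] != 0 -> p%:F != 0 :> parfield R.
Proof. by rewrite tofrac_eq0; apply: contra_neq => ->; rewrite meval0. Qed.

Lemma raise_g_par_neq0 (R : realType) :
  2 * (par_a R + par_b R + par_c R) + 3 * (par_g R + 2) != 0.
Proof.
pose X i : {mpoly R[i][4]} := 'X_i.
(* At the origin the value is 6. *)
have := @parfield_neq0 R (fun=> 0)
  (2 * (X (@Ordinal 4 0 isT) + X (@Ordinal 4 1 isT) + X (@Ordinal 4 2 isT))
     + 3 * (X (@Ordinal 4 3 isT) + 2)).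
rewrite !(rmorph_nat, rmorphD, rmorphM) /X /=.
rewrite !mevalXU; apply.
by rewrite !addr0 mulr0 !add0r -natrM pnatr_eq0.
Qed.

Lemma lower_g_par_neq0 (R : realType) :
  (2 * par_c R + par_g R) * (par_a R + par_b R + par_g R) != 0.
Proof.
pose X i : {mpoly R[i][4]} := 'X_i.
(* The polynomial is homogeneous, so the origin does not help; at (1, 1, 1, 1) the value is 9. *)
have := @parfield_neq0 R (fun=> 1)
  ((2 * X (@Ordinal 4 2 isT) + X (@Ordinal 4 3 isT))
     * (X (@Ordinal 4 0 isT) + X (@Ordinal 4 1 isT) + X (@Ordinal 4 3 isT))).
rewrite !(rmorph_nat, rmorphD, rmorphM) /X /=.
rewrite !mevalXU; apply.
have -> : (2 * 1 + 1) * (1 + 1 + 1) = 9 :> R[i] by ring.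
by rewrite pnatr_eq0.
Qed.

Theorem theorem2p3 (R : realType) :
  let SE3 := @DF (parfield R) in
  (admits_shift SE3 1 0 0 0 /\ admits_shift SE3 (-1) 0 0 0)
  /\ (admits_shift SE3 0 1 0 0 /\ admits_shift SE3 0 (-1) 0 0)
  /\ (admits_shift SE3 0 0 1 0 /\ admits_shift SE3 0 0 (-1) 0)
  /\ (admits_shift SE3 0 0 0 2 /\ admits_shift SE3 0 0 0 (-2)).
Proof.
move=> SE3; do ![split].
- exact: DF_raise_a.
- exact: DF_lower_a.
- exact: DF_raise_b.
- exact: DF_lower_b.
- exact: DF_raise_c.
- exact: DF_lower_c.
- exact: DF_raise_g (raise_g_par_neq0 R).
- exact: DF_lower_g (lower_g_par_neq0 R).
Qed.
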